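(* Let $V:\mathbb{R}^n\to\mathbb{R}$ be a continuous function that is bounded below, and let $x\in\mathbb{R}^n$, $d\in S^{n-1}$ and $\tau>0$. Then (at least) one of the following statements holds. (i) There is a $\beta\in\mathbb{R}$, $\beta\neq 0$, such that $$\frac{V(x-\tau\beta d)-V(x)}{\tau\beta}=-\beta .$$ (ii) $V$ is Clarke directionally stationary at $x$ along $d$, i.e. $\min\{V^o(x;d),V^o(x;-d)\}\geq 0$.
   Context: $S^{n-1}=\{x\in\mathbb{R}^n:\|x\|=1\}$ is the Euclidean unit sphere. For $x,d\in\mathbb{R}^n$, the Clarke directional derivative is $$V^o(x;d)=\limsup_{y\to x,\ \lambda\downarrow 0}\frac{V(y+\lambda d)-V(y)}{\lambda},$$ understood as an element of $[-\infty,+\infty]$. For $d\neq 0$, $V$ is called Clarke directionally stationary at $x$ along $d$ if $\min\{V^o(x;d),V^o(x;-d)\}\geq 0$. *)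

(* Defs.v *)
From mathcomp Require Import all_boot all_order all_algebra.
From mathcomp Require Import all_classical all_reals all_analysis.
Import Order.TTheory GRing.Theory Num.Theory.
Import numFieldNormedType.Exports.

Set Implicit Arguments.
Unset Strict Implicit.
Unset Printing Implicit Defensive.

Local Open Scope classical_set_scope.
Local Open Scope ring_scope.

(* The library norm `|x| on 'rV[R]_n is the max norm: it induces the usual
   topology of R^n but not the Euclidean sphere, hence a separate norm. *)
Definition enorm (R : realType) (n : nat) (x : 'rV[R]_n) : R :=
  Num.sqrt (\sum_(i < n) x ord0 i ^+ 2).

Definition unit_sphere (R : realType) (n : nat) : set 'rV[R]_n :=
  [set x | enorm x = 1].

Arguments unit_sphere R n : clear implicits.

(* The limsup is joint in (y, lambda), and y = x is allowed. *)
Definition clarke_derivative (R : realType) (n : nat) (V : 'rV[R]_n -> R)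
    (x d : 'rV[R]_n) : \bar R :=
  limf_esup (fun p : 'rV[R]_n * R => ((V (p.1 + p.2 *: d) - V p.1) / p.2)%:E)
    (filter_prod (nbhs x) (0 : R)^'+).

(* Intended for d != 0. *)
Definition clarke_stationary (R : realType) (n : nat) (V : 'rV[R]_n -> R)
    (x d : 'rV[R]_n) : Prop :=
  (0 <= mine (clarke_derivative V x d) (clarke_derivative V x (- d)))%E.

(* Main.v *)
Require Import Defs.
From mathcomp Require Import all_boot all_order all_algebra.
From mathcomp Require Import all_classical all_reals all_analysis.
From mathcomp Require Import ring lra.
Import Order.TTheory GRing.Theory Num.Theory.
Import numFieldNormedType.Exports.

Local Open Scope classical_set_scope.
Local Open Scope ring_scope.

(** Put s = - tau * beta.  Alternative (i) says that the continuous function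
    V (x + s *: d) + s ^+ 2 / tau takes the value V x at some s other than 0.
    Since V is bounded below, this function tends to +oo along both half-lines,
    so if it never takes the value V x away from 0, the intermediate value
    theorem forces it to stay above V x ([parabola_minorant]).  Then V is
    minorised along the line by the parabola V x - s ^+ 2 / tau, which touches
    V at x with slope 0, so the difference quotients based at x itself have a
    nonnegative limsup in both directions ([clarke_derivative_ge0]); since base
    points y = x are admitted in the Clarke derivative, it is nonnegative. *)

(** Every neighbourhood in the limsup contains the pairs (x, s) with s small
    and positive, where the quotient is at least - s / C; as s goes to 0 the
    supremum over the neighbourhood is nonnegative. *)
Lemma clarke_derivative_ge0 (R : realType) (n : nat) (V : 'rV[R]_n -> R)
    (x d : 'rV[R]_n) (C : R) :
  0 < C ->
  (forall s, 0 < s -> V x - s ^+ 2 / C <= V (x + s *: d)) ->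
  (0 <= clarke_derivative V x d)%E.
Proof.
move=> C_gt0 V_ge; apply: le_ereal_inf_tmp => _ [A [[/= B0 B1] [B0x B1_0] BA] <-].
apply/lee_addgt0Pr => e e_gt0; rewrite -leeBlDr//.
(* On the quotient at (x, s) the bound costs s / C, so s < e * C suffices. *)
have [s [B1s /andP[s_gt0 s_lt]]] : exists s, B1 s /\ 0 < s < e * C.
  apply: (@filter_ex _ 0^'+); near=> s; split; first by near: s.
  apply/andP; split; first by near: s; exact: nbhs_right_gt.
  by near: s; apply: nbhs_right_lt; rewrite mulr_gt0.
apply: le_trans (ereal_sup_ubound _); last first.
  by exists (x, s) => //; apply: BA; split => //; exact: nbhs_singleton.
rewrite /= lee_fin sub0r ler_pdivlMr//.
apply: (@le_trans _ _ (- (s ^+ 2 / C))); last first.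
  by have := V_ge s s_gt0; lra.
rewrite mulNr lerN2 ler_pdivrMr// expr2 mulrAC ler_wpM2r//; exact: ltW.
Unshelve. all: by end_near. Qed.

(** A point s below the parabola is one where phi s + s ^+ 2 / tau < phi 0,
    while this sum is at least phi 0 far out because phi is bounded below; it would
    take the value phi 0 in between. *)
Lemma parabola_minorant {R : realType} (phi : R -> R) (tau : R) :
  continuous phi -> has_lbound (range phi) -> 0 < tau ->
  (forall s, 0 < s -> phi s + s ^+ 2 / tau != phi 0) ->
  forall s, 0 < s -> phi 0 - s ^+ 2 / tau <= phi s.
Proof.
move=> phi_cont [m m_lb] tau_gt0 phi_neq s s_gt0; rewrite lerBlDr leNgt.
apply/negP => s_below.
have m_le u : m <= phi u by apply: m_lb; exists u.
(* At t both t >= tau and t >= phi 0 - m, so t ^+ 2 / tau >= phi 0 - m. *)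
pose t := s + tau + (phi 0 - m).
have t_above : phi 0 <= phi t + t ^+ 2 / tau.
  rewrite -lerBlDl; apply: (@le_trans _ _ (phi 0 - m)); first by rewrite lerB.
  rewrite ler_pdivlMr// /t; have := m_le 0; nra.
have st : s <= t by have := m_le 0; rewrite /t; lra.
have [||u /itvP u_st phi_u] :=
    @IVT R (fun u => phi u + u ^+ 2 / tau) s t (phi 0) st.
- apply: continuous_subspaceT => u; apply: cvgD; first exact: phi_cont.
  by apply: cvgMr_tmp; exact: exprn_continuous.
- by rewrite ge_min le_max (ltW s_below) t_above orbT.
have /phi_neq : 0 < u by rewrite (lt_le_trans s_gt0)// u_st.
by rewrite phi_u eqxx.
Qed.

(** Isolates one half-line: the directions d and - d correspond to the two
    signs of beta. *)
Lemma clarke_derivative_ge0_half_line (R : realType) (n : nat)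
    (V : 'rV[R]_n -> R) (x d : 'rV[R]_n) (tau : R) :
  continuous V -> has_lbound (range V) -> 0 < tau ->
  (forall s, 0 < s -> V (x + s *: d) + s ^+ 2 / tau != V x) ->
  (0 <= clarke_derivative V x d)%E.
Proof.
move=> V_cont [m m_lb] tau_gt0 V_neq.
apply: (clarke_derivative_ge0 _ _ _ _ _ _ tau_gt0).
have phi0 : V (x + (0 : R) *: d) = V x by rewrite scale0r addr0.
rewrite -phi0.
apply: (parabola_minorant (fun s => V (x + s *: d))) => //.
- move=> s; apply: continuous_comp; last exact: V_cont.
  by apply: cvgD; [exact: cvg_cst | apply: cvgZr_tmp; exact: cvg_id].
- by exists m => _ [s _ <-]; apply: m_lb; exists (x + s *: d).
- by move=> s s_gt0; rewrite phi0; exact: V_neq.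
Qed.

Theorem lemma3p1 (R : realType) (n : nat) (V : 'rV[R]_n -> R)
    (V_continuous : continuous V) (V_bounded_below : has_lbound (range V))
    (x d : 'rV[R]_n) (d_unit : unit_sphere R n d)
    (tau : R) (tau_gt0 : 0 < tau) :
  (exists2 beta : R, beta != 0 &
     (V (x - (tau * beta) *: d) - V x) / (tau * beta) = - beta)
  \/ clarke_stationary V x d.
Proof.
have [?|no_beta] := pselect (exists2 beta : R, beta != 0 &
  (V (x - (tau * beta) *: d) - V x) / (tau * beta) = - beta); first by left.
have tau_neq0 := lt0r_neq0 tau_gt0.
have V_neq s : s != 0 -> V (x + s *: d) + s ^+ 2 / tau != V x.
  move=> s_neq0; apply/eqP => V_s; apply: no_beta; exists (- s / tau).
    by rewrite mulf_neq0 ?oppr_eq0 ?invr_eq0.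
  have -> : tau * (- s / tau) = - s by field.
  by rewrite scaleNr opprK -V_s; field; rewrite tau_neq0 s_neq0.
right; rewrite /clarke_stationary le_min; apply/andP; split;
  apply: (clarke_derivative_ge0_half_line _ _ _ _ _ _ V_continuous
            V_bounded_below tau_gt0) => s s_gt0.
- by apply: V_neq; rewrite gt_eqF.
- by rewrite scalerN -scaleNr -sqrrN; apply: V_neq; rewrite oppr_eq0 gt_eqF.
Qed.
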